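(* Let $M$ be a (topological, smooth, analytic, or algebraic) manifold, $G$ a group of the corresponding kind, and $\mathcal U=\{U_\lambda\}_{\lambda\in\Lambda}$ an open cover of $M$. The assignment to a system $\{g_{\sigma,\tau}\}$ of $G$-valued transition functions on $M$ relative to the open cover $B\mathcal U$ of the functor $F\colon\mathcal M_{\mathcal U}\to G$ characterized by $$F|_{U_{\sigma_0\subseteq\sigma_1}}=g_{\sigma_0,\sigma_1}\colon U_{\sigma_0\subseteq\sigma_1}=U_{\sigma_1}\longrightarrow G,\qquad \sigma_0\subseteq\sigma_1,$$ induces a bijection $$\mathrm H^1(B\mathcal U,G)\longrightarrow\mathcal D(\mathcal M_{\mathcal U},G),$$ and this bijection is natural in the data.
   Context: All maps are taken in the category considered (continuous, smooth, analytic, algebraic). For a nonempty finite subset $\sigma\subseteq\Lambda$ let $U_\sigma=\bigcap_{\alpha\in\sigma}U_\alpha$. $B\mathcal U$ is the open cover of $M$ consisting of the nonempty $U_\sigma$, indexed by these finite subsets $\sigma$; for $\tau\subseteq\sigma$ one has $U_\sigma\subseteq U_\tau$. The category $\mathcal M_{\mathcal U}$ (Segal): its space of objects is the disjoint union $\coprod_\sigma U_\sigma$ of the nonempty $U_\sigma$, so objects are pairs $(x,U_\sigma)$ with $x\in U_\sigma$. Its space of morphisms is $\coprod_{\sigma_0\subseteq\sigma_1}U_{\sigma_0\subseteq\sigma_1}$, over inclusions of finite subsets with $U_{\sigma_1}$ nonempty, where $U_{\sigma_0\subseteq\sigma_1}=U_{\sigma_1}$. The source map $s\colon U_{\sigma_0\subseteq\sigma_1}=U_{\sigma_1}\to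 U_{\sigma_0}$ is the inclusion, the target map $t\colon U_{\sigma_0\subseteq\sigma_1}=U_{\sigma_1}\to U_{\sigma_1}$ is the identity, and the identities are $U_{\sigma_0}=U_{\sigma_0\subseteq\sigma_0}$. For $\sigma_0\subseteq\sigma_1\subseteq\sigma_2$ and $x\in U_{\sigma_2}$ the composite of the morphisms given by $(x,\sigma_0\subseteq\sigma_1)$ and $(x,\sigma_1\subseteq\sigma_2)$ is $(x,\sigma_0\subseteq\sigma_2)$. Composition is written in diagrammatic order, and a functor $F\colon\mathcal M_{\mathcal U}\to G$ ($G$ a category with one object) satisfies $F(f_1f_2)=F(f_1)F(f_2)$; thus $F(x,\sigma_0\subseteq\sigma_2)=F(x,\sigma_0\subseteq\sigma_1)F(x,\sigma_1\subseteq\sigma_2)$. $\mathcal D(\mathcal M_{\mathcal U},G)=\mathrm{Funct}(\mathcal M_{\mathcal U},G)/\mathrm{Map}(\mathrm{Ob}(\mathcal M_{\mathcal U}),G)$, where $\Phi\in\mathrm{Map}(\mathrm{Ob}(\mathcal M_{\mathcal U}),G)$ sends $F_1$ to $F_2$ if and only if $F_1(f)\Phi(y)=\Phi(x)F_2(f)$ for every morphism $f$ from $x$ to $y$. A system of $G$-valued transition functions on $M$ relative to an open cover $\{V_i\}_{i\in I}$ is a family of maps $g_{i,j}\colon V_i\cap V_j\to G$ ($i,j\in I$) with $g_{i,k}(y)=g_{i,j}(y)g_{j,k}(y)$ for $y\in V_i\cap V_j\cap V_k$. Two systems $\{g_{i,j}\},\{g'_{i,j}\}$ are equivalent if there are maps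 $r_i\colon V_i\to G$ with $g'_{i,j}(y)=r_i(y)^{-1}g_{i,j}(y)r_j(y)$ for $y\in V_i\cap V_j$. The set of equivalence classes is $\mathrm H^1(\{V_i\},G)$. *)

(* Defs.v *)
From HB Require Import structures.
From mathcomp Require Import all_boot all_order all_algebra.
From mathcomp Require Import finmap complex.
From mathcomp Require Import -(notations) mpoly.
From mathcomp Require Import all_classical all_reals all_analysis.
Import Order.TTheory GRing.Theory Num.Theory.
Import numFieldNormedType.Exports.

Set Implicit Arguments.
Unset Strict Implicit.
Unset Printing Implicit Defensive.

Local Open Scope classical_set_scope.
Local Open Scope ring_scope.

(* Manifolds of every kind are treated as topological spaces with a sheaf of
   K-valued functions.  The sheaf is given by its germs: regular x f says that
   f is a section on some neighbourhood of x, so that the sections on an open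
   set U are the functions regular at every point of U. *)

Record space (K : Type) := Space {
  carrier :> topologicalType;
  regular : carrier -> (carrier -> K) -> Prop;
  regular_near : forall x f,
    regular x f -> \forall y \near x, regular y f;
  regular_germ : forall x f g,
    (\forall y \near x, f y = g y) -> regular x f -> regular x g }.

Definition is_map K (X Y : space K) (f : X -> Y) : Prop :=
  continuous f /\
  forall (x : X) (h : Y -> K), regular (f x) h -> regular x (h \o f).

Definition isomorphic K (X Y : space K) : Prop :=
  exists (f : X -> Y) (g : Y -> X),
    [/\ is_map f, is_map g, cancel f g & cancel g f].

Definition inset T (A : set T) (x : T) (Ax : A x) : A := exist _ x (mem_set Ax).

Lemma insetP T (A : set T) (x : A) : A (set_val x).
Proof. exact: set_valP. Qed.

Section Induced.
Variables (K : Type) (X : space K) (A : set X).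

(* On an arbitrary subset A, the functions that locally extend to regular
   functions of X; for A open this is the restriction of the sheaf to A. *)
Definition induced_regular (x : A) (f : A -> K) : Prop :=
  exists2 g : X -> K,
    regular (set_val x) g & \forall y \near x, f y = g (set_val y).

Lemma set_val_near (x : A) (P : set X) :
  (\forall z \near set_val x, P z) -> \forall y \near x, P (set_val y).
Proof. exact: (@initial_continuous A X set_val x P). Qed.

Lemma induced_regular_near x f :
  induced_regular x f -> \forall y \near x, induced_regular y f.
Proof.
case=> g /regular_near/set_val_near gx /near_join fg.
by near=> y; exists g; near: y.
Unshelve. all: by end_near. Qed.

Lemma induced_regular_germ x f g : (\forall y \near x, f y = g y) ->
  induced_regular x f -> induced_regular x g.
Proof.
move=> fg [h hx fh]; exists h => //.
by apply: filterS2 fg fh => y <- ->.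
Qed.

Definition induced : space K :=
  @Space K A induced_regular induced_regular_near
    induced_regular_germ.

End Induced.

Section Coproduct.
Variables (K : Type) (I : choiceType) (X : I -> space K).

Definition coprod_carrier : topologicalType := {i : I & (X i : topologicalType)}.

Definition coprod_regular (x : coprod_carrier) (f : coprod_carrier -> K) :=
  regular (projT2 x) (fun y => f (existT _ (projT1 x) y)).

Lemma coprod_regular_near x f :
  coprod_regular x f -> \forall y \near x, coprod_regular y f.
Proof. by case: x => i x; exact: regular_near. Qed.

Lemma coprod_regular_germ x f g : (\forall y \near x, f y = g y) ->
  coprod_regular x f -> coprod_regular x g.
Proof. by case: x => i x; exact: regular_germ. Qed.

Definition coprod : space K :=
  @Space K coprod_carrier coprod_regular coprod_regular_near
    coprod_regular_germ.

End Coproduct.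

Section MapLemmas.
Variable K : Type.

Lemma is_map_comp (X Y Z : space K) (g : Y -> Z) (f : X -> Y) :
  is_map g -> is_map f -> is_map (g \o f).
Proof.
move=> [cg rg] [cf rf]; split.
  by move=> x; apply: continuous_comp; [exact: cf | exact: cg].
by move=> x h hx; apply: (rf x (h \o g)); exact: rg.
Qed.

Lemma is_map_set_val (X : space K) (A : set X) :
  @is_map K (induced A) X set_val.
Proof.
split; first exact: initial_continuous.
move=> x h hx; exists h; first exact: hx. by exact: (@filterE _ (nbhs (x : induced A))).
Qed.

Lemma is_map_induced (X Y : space K) (B : set Y) (f : X -> induced B) :
  @is_map K X Y (set_val \o f) -> is_map f.
Proof.
move=> [cf rf]; have cf' : continuous f by apply/continuous_comp_initial.
split=> // x h [g gx hg]; apply: regular_germ (rf x g gx).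
by near=> y => /=; apply/esym; near: y; exact: (cf' x _ hg).
Unshelve. all: by end_near. Qed.

Lemma is_map_coprod (I : choiceType) (X : I -> space K) (Y : space K)
    (f : coprod X -> Y) :
  (forall i, @is_map K (X i) Y (fun x => f (existT _ i x))) -> is_map f.
Proof.
move=> fm; split=> [[i x]|[i x] h hx].
  by move=> B /(proj1 (fm i) x).
exact: (proj2 (fm i) x h hx).
Qed.

Lemma is_map_existT (I : choiceType) (X : I -> space K) (i : I) :
  @is_map K (X i) (coprod X) (fun x => existT _ i x).
Proof. by split=> [x B|x h]. Qed.

End MapLemmas.

Section NearSpace.
Variables (K : Type) (T : topologicalType) (P : T -> (T -> K) -> Prop).
Hypothesis P_germ : forall (x : T) (f g : T -> K),
  (\forall y \near x, f y = g y) -> P x f -> P x g.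

Lemma near_space_near (x : T) (f : T -> K) : (\forall y \near x, P y f) ->
  \forall y \near x, \forall z \near y, P z f.
Proof. exact: near_join. Qed.

Lemma near_space_germ (x : T) (f g : T -> K) : (\forall y \near x, f y = g y) ->
  (\forall y \near x, P y f) -> \forall y \near x, P y g.
Proof. by move=> /near_join fg; apply: filterS2 fg => y; exact: P_germ. Qed.

(* The space on T whose sections on an open set are the functions satisfying
   the pointwise condition P everywhere on it. *)
Definition near_space : space K :=
  @Space K T (fun (x : T) f => \forall y \near x, P y f)
    near_space_near near_space_germ.

End NearSpace.
Arguments near_space {K T} P P_germ.

Lemma near_eq_continuous (T U : topologicalType) (x : T) (f g : T -> U) :
  (\forall y \near x, f y = g y) ->
  {for x, continuous f} -> {for x, continuous g}.
Proof.
move=> fg cf; have fgx := nbhs_singleton fg.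
rewrite /prop_for /continuous_at -fgx.
exact: cvg_trans (near_eq_cvg fg) cf.
Qed.

Section Smooth.
Variables (R : realType) (n : nat).
Implicit Types (f : 'rV[R]_n -> R) (x : 'rV[R]_n).

Fixpoint Ck (m : nat) f x : Prop :=
  if m is m'.+1 then
    (\forall y \near x, {for y, continuous f} /\
       forall i : 'I_n, derivable (f : _ -> R^o) y (delta_mx 0 i)) /\
    forall i : 'I_n, Ck m' ('D_(delta_mx 0 i) (f : _ -> R^o)) x
  else \forall y \near x, {for y, continuous f}.

Definition smooth_at x f : Prop := forall m, Ck m f x.

Lemma Ck_germ m x f g : (\forall y \near x, f y = g y) -> Ck m f x -> Ck m g x.
Proof.
elim: m x f g => [|m IH] x f g /near_join fg /=.
  by apply: filterS2 fg => y; exact: near_eq_continuous.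
case=> fx Df; split.
  apply: filterS2 fg fx => y fgy [cf df]; split.
    exact: near_eq_continuous fgy cf.
  by move=> i; apply: near_eq_derivable (df i).
move=> i; apply: IH (Df i).
by apply: filterS fg => y fgy; exact: near_eq_derive.
Qed.

Lemma smooth_at_germ x f g :
  (\forall y \near x, f y = g y) -> smooth_at x f -> smooth_at x g.
Proof. by move=> fg fx m; apply: Ck_germ fg (fx m). Qed.

End Smooth.

Section Analytic.
Variables (K : numFieldType) (n : nat).
Implicit Types (f : 'rV[K]_n -> K) (x : 'rV[K]_n).

Definition power_term (c : ('I_n -> nat) -> K) (a y : 'rV[K]_n)
    (m : 'I_n -> nat) : K :=
  c m * \prod_(i < n) (y 0 i - a 0 i) ^+ m i.

(* Absolute convergence is expressed by boundedness of the partial sums, taken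
   over the exponents m with all m i < N. *)
Definition analytic_at a f : Prop :=
  exists c : ('I_n -> nat) -> K, \forall y \near a,
    (exists B : K, forall N : nat,
      \sum_(m : {ffun 'I_n -> 'I_N})
        `|power_term c a y (fun i => m i)| <= B) /\
    (fun N : nat => \sum_(m : {ffun 'I_n -> 'I_N})
        power_term c a y (fun i => m i) : K^o) @ \oo --> (f y : K^o).

Lemma analytic_at_germ x f g :
  (\forall y \near x, f y = g y) -> analytic_at x f -> analytic_at x g.
Proof.
move=> fg [c fc]; exists c.
by apply: filterS2 fg fc => y <-.
Qed.

End Analytic.

Section Zariski.
Variables (k : fieldType) (n : nat).

Definition zariski : Type := 'rV[k]_n.
HB.instance Definition _ := Choice.on zariski.

Definition peval (p : mpoly n k) (x : zariski) : k :=
  meval (fun i => (x : 'rV[k]_n) 0 i) p.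

(* The principal open sets p != 0 form a base. *)
Definition zariski_open : set_system zariski :=
  [set A | forall x, A x ->
    exists2 p, peval p x != 0 & [set y | peval p y != 0] `<=` A].

Lemma zariski_openT : zariski_open setT.
Proof.
by move=> x _; exists 1 => //; rewrite /peval meval1 oner_neq0.
Qed.

Lemma zariski_openI : setI_closed zariski_open.
Proof.
move=> A B oA oB x [/oA[p px pA] /oB[q qx qB]].
exists (p * q); first by rewrite /peval mevalM mulf_neq0.
move=> y /=; rewrite /peval mevalM mulf_eq0 negb_or => /andP[py qy].
by split; [exact: pA | exact: qB].
Qed.

Lemma zariski_open_bigU (I : Type) (f : I -> set zariski) :
  (forall i, zariski_open (f i)) -> zariski_open (\bigcup_i f i).
Proof.
move=> of_ x [i _ /(of_ i)[p px pf]]; exists p => // y py.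
by exists i => //; exact: pf.
Qed.

HB.instance Definition _ := isOpenTopological.Build zariski
  zariski_openT zariski_openI zariski_open_bigU.

Definition rational_at (x : zariski) (f : zariski -> k) : Prop :=
  exists p q, \forall y \near x, peval q y != 0 /\ f y = peval p y / peval q y.

Lemma rational_at_germ (x : zariski) f g :
  (\forall y \near x, f y = g y) -> rational_at x f -> rational_at x g.
Proof.
move=> fg [p [q fx]]; exists p, q.
by apply: filterS2 fg fx => y <-.
Qed.

(* Jacobian criterion: V is cut out of an open subset of affine space by r
   equations whose differentials are linearly independent along V. *)
Definition nonsingular (V : set zariski) : Prop :=
  exists (W : set zariski) (r : nat) (p : 'I_r -> mpoly n k),
    [/\ open W,
        V = [set x | W x /\ forall i, peval (p i) x = 0] &
        forall x, V x ->
          row_free (\matrix_(i < r, j < n) peval (mderiv j (p i)) x)].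

End Zariski.

(* Algebraic manifolds over k are nonsingular varieties in the
   classical sense, with their k-points, Zariski topology and regular
   functions. *)
Inductive kind :=
  Topological | Smooth | RealAnalytic | ComplexAnalytic
| Algebraic of fieldType.

Section Categories.
Variable R : realType.

Definition scalar (c : kind) : Type :=
  match c with
  | Topological | Smooth | RealAnalytic => R
  | ComplexAnalytic => R[i]
  | Algebraic k => k
  end.

Definition affine (c : kind) (n : nat) : space (scalar c) :=
  match c return space (scalar c) with
  | Topological => near_space (fun (x : 'rV[R]_n) (f : 'rV[R]_n -> R) =>
      {for x, continuous f}) (@near_eq_continuous 'rV[R]_n R)
  | Smooth => near_space (@smooth_at R n) (@smooth_at_germ R n)
  | RealAnalytic => near_space (@analytic_at R n) (@analytic_at_germ R n)
  | ComplexAnalytic =>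
      near_space (@analytic_at R[i] n) (@analytic_at_germ R[i] n)
  | Algebraic k => near_space (@rational_at k n) (@rational_at_germ k n)
  end.

Definition is_model (c : kind) (n : nat) : set (affine c n) -> Prop :=
  match c return set (affine c n) -> Prop with
  | Algebraic k => @nonsingular k n
  | Topological => @open (affine Topological n)
  | Smooth => @open (affine Smooth n)
  | RealAnalytic => @open (affine RealAnalytic n)
  | ComplexAnalytic => @open (affine ComplexAnalytic n)
  end.

Definition locally_model (c : kind) (X : space (scalar c)) : Prop :=
  forall x : X, exists (U : set X) (n : nat) (V : set (affine c n)),
    [/\ open U, U x, is_model V & isomorphic (induced U) (induced V)].

(* For varieties the diagonal of X is closed in the product X * X (not in the
   product topology); equivalently two maps into X agree on a closed set. *)
Definition separated (c : kind) (X : space (scalar c)) : Prop :=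
  if c is Algebraic _ then
    forall (Y : space (scalar c)) (f g : Y -> X), locally_model Y ->
      is_map f -> is_map g -> closed [set y | f y = g y]
  else hausdorff_space X.

Definition is_manifold (c : kind) (X : space (scalar c)) : Prop :=
  locally_model X /\ separated X.

Definition is_continuous_space (X : space R) : Prop :=
  forall (x : X) (f : X -> R),
    regular x f <-> \forall y \near x, {for y, continuous f}.

(* The category considered.  In the topological case it consists of all
   topological spaces, so that G may be any topological group. *)
Definition is_object (c : kind) : space (scalar c) -> Prop :=
  match c return space (scalar c) -> Prop with
  | Topological => is_continuous_space
  | c' => @is_manifold c'
  end.

Record manifold (c : kind) := Manifold {
  manifold_space :> space (scalar c);
  manifoldP : is_manifold manifold_space }.

Definition is_product (c : kind) (X Y P : space (scalar c))
    (p1 : P -> X) (p2 : P -> Y) : Prop :=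
  [/\ is_object P, is_map p1, is_map p2 &
      forall (T : space (scalar c)) (f : T -> X) (g : T -> Y),
        is_object T -> is_map f -> is_map g ->
        exists! h : T -> P, [/\ is_map h, p1 \o h = f & p2 \o h = g]].

(* Group objects of the category: topological, Lie, complex Lie or algebraic
   groups.  The product G * G is the one of the category; for algebraic groups
   it does not carry the product topology. *)
Record group_of (c : kind) := GroupOf {
  group_space :> space (scalar c);
  group_object : is_object group_space;
  gone : group_space;
  gmul : group_space -> group_space -> group_space;
  ginv : group_space -> group_space;
  gmulA : associative gmul;
  gmul1g : left_id gone gmul;
  gmulVg : left_inverse gone ginv gmul;
  gmul_map : exists (P : space (scalar c)) (p1 p2 : P -> group_space),
    is_product p1 p2 /\ is_map (fun z => gmul (p1 z) (p2 z));
  ginv_map : is_map ginv }.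

Record group_hom (c : kind) (G G' : group_of c) := GroupHom {
  hom_fun :> G -> G';
  hom_map : is_map hom_fun;
  hom_mul : forall a b, hom_fun (gmul a b) = gmul (hom_fun a) (hom_fun b) }.

End Categories.

Section Classes.
Variables (T : Type) (e : T -> T -> Prop).

Definition classes : Type := {C : set T | exists x, C = [set y | e x y]}.

Definition class_of (x : T) : classes :=
  exist _ [set y | e x y] (ex_intro _ x erefl).

End Classes.

Section TransitionFunctions.
Variables (R : realType) (c : kind) (M : manifold R c) (G : group_of R c).
Variables (I : Type) (V : I -> set M).

Record transition_system := TransitionSystem {
  tf : forall i j, induced (V i `&` V j) -> G;
  tf_map : forall i j, is_map (@tf i j);
  tf_cocycle : forall i j k y (yi : V i y) (yj : V j y) (yk : V k y),
    @tf i k (inset (conj yi yk)) =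
    gmul (@tf i j (inset (conj yi yj))) (@tf j k (inset (conj yj yk))) }.

Definition system_equiv (g g' : transition_system) : Prop :=
  exists r : forall i, induced (V i) -> G,
    (forall i, is_map (r i)) /\
    forall i j y (yi : V i y) (yj : V j y),
      tf g' (inset (conj yi yj)) =
      gmul (gmul (ginv (r i (inset yi))) (tf g (inset (conj yi yj))))
           (r j (inset yj)).

Definition H1 : Type := classes system_equiv.

End TransitionFunctions.

Record open_cover (T : topologicalType) (L : choiceType) := OpenCover {
  cover_set :> L -> set T;
  cover_open : forall l, open (cover_set l);
  cover_full : \bigcup_l cover_set l = setT }.

Section CoverCategory.
Variables (T : topologicalType) (L : choiceType) (U : open_cover T L).

Definition finite_meet (s : {fset L}) : set T := \bigcap_(l in [set` s]) U l.

Definition Bindex : choiceType :=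
  {s : {fset L} | (s != fset0) && `[< finite_meet s !=set0 >]}.

Definition Bcover (s : Bindex) : set T := finite_meet (val s).

Definition Bpair : choiceType :=
  {p : Bindex * Bindex | (val p.1 `<=` val p.2)%fset}.

Definition bsrc (p : Bpair) : Bindex := (val p).1.
Definition btgt (p : Bpair) : Bindex := (val p).2.

Lemma Bcover_sub (p : Bpair) : Bcover (btgt p) `<=` Bcover (bsrc p).
Proof.
move=> x Ux l /= ls; apply: Ux => /=.
by move: (valP p) => /fsubsetP/(_ l ls).
Qed.

Definition Bpair_id (s : Bindex) : Bpair := exist _ (s, s) (fsubset_refl _).

Lemma Bpair_comp_subproof (p q : Bpair) : btgt p = bsrc q ->
  (val (bsrc p) `<=` val (btgt q))%fset.
Proof.
move=> e; apply: fsubset_trans (valP q).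
by rewrite -[(val q).1]e; exact: (valP p).
Qed.

Definition Bpair_comp (p q : Bpair) (e : btgt p = bsrc q) : Bpair :=
  exist _ (bsrc p, btgt q) (Bpair_comp_subproof e).

End CoverCategory.

Section SegalCategory.
Variables (K : Type) (M : space K) (L : choiceType) (U : open_cover M L).

Definition MUob : space K := coprod (fun s : Bindex U => induced (Bcover s)).
Definition MUmor : space K :=
  coprod (fun p : Bpair U => induced (Bcover (btgt p))).

Definition MUsrc (f : MUmor) : MUob :=
  existT _ (bsrc (projT1 f)) (inset (Bcover_sub (insetP (projT2 f)))).
Definition MUtgt (f : MUmor) : MUob := existT _ (btgt (projT1 f)) (projT2 f).
Definition MUid (x : MUob) : MUmor := existT _ (Bpair_id (projT1 x)) (projT2 x).

Definition MUcomp (f g : MUmor) (e : MUtgt f = MUsrc g) : MUmor :=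
  existT _ (Bpair_comp (congr1 (@projT1 _ _) e)) (projT2 g).

End SegalCategory.

Section Functors.
Variables (R : realType) (c : kind) (M : manifold R c) (G : group_of R c).
Variables (L : choiceType) (U : open_cover M L).

Record functor := Functor {
  fmor :> MUmor U -> G;
  fmor_map : is_map fmor;
  fmor_id : forall x : MUob U, fmor (MUid x) = gone G;
  fmor_comp : forall (f1 f2 : MUmor U) (e : MUtgt f1 = MUsrc f2),
    fmor (MUcomp e) = gmul (fmor f1) (fmor f2) }.

Definition functor_equiv (F1 F2 : functor) : Prop :=
  exists Phi : MUob U -> G, is_map Phi /\
    forall f : MUmor U,
      gmul (F1 f) (Phi (MUtgt f)) = gmul (Phi (MUsrc f)) (F2 f).

Definition DMU : Type := classes functor_equiv.

(* F restricted to U_{s0 <= s1} = U_s1 is g s0 s1 *)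
Definition restricts_to (F : functor)
    (g : transition_system G (@Bcover _ _ U)) : Prop :=
  forall (p : Bpair U) (x : induced (Bcover (btgt p))),
    F (existT _ p x) =
    tf g (i := bsrc p) (j := btgt p)
      (inset (conj (Bcover_sub (insetP x)) (insetP x))).

Section FunctorOf.
Variable g : transition_system G (@Bcover _ _ U).

Definition functor_of_fun (f : MUmor U) : G :=
  tf g (inset (conj (Bcover_sub (insetP (projT2 f))) (insetP (projT2 f)))).

Lemma functor_of_map : is_map functor_of_fun.
Proof.
apply: is_map_coprod => p.
pose h (x : induced (Bcover (btgt p))) :
    induced (Bcover (bsrc p) `&` Bcover (btgt p)) :=
  inset (conj (Bcover_sub (insetP x)) (insetP x)).
have hm : is_map h by apply: is_map_induced; exact: is_map_set_val.
exact: is_map_comp (tf_map g _ _) hm.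
Qed.

Lemma tf_eq i j j' (a : induced (Bcover i `&` Bcover j))
    (b : induced (Bcover i `&` Bcover j')) :
  j = j' -> set_val a = set_val b -> tf g a = tf g b.
Proof. by move=> e; subst j' => /val_inj->. Qed.

Lemma gmul_idem (a : G) : a = gmul a a -> a = gone G.
Proof. by move=> e; rewrite -[LHS](gmul1g a) -(gmulVg a) -gmulA -e. Qed.

Lemma functor_of_id (x : MUob U) : functor_of_fun (MUid x) = gone G.
Proof.
case: x => s x; apply: gmul_idem; rewrite /functor_of_fun /=.
have := tf_cocycle g (insetP x) (insetP x) (insetP x).
by congr (_ = gmul _ _); congr (tf g _); exact: val_inj.
Qed.

Lemma functor_of_comp (f1 f2 : MUmor U) (e : MUtgt f1 = MUsrc f2) :
  functor_of_fun (MUcomp e) = gmul (functor_of_fun f1) (functor_of_fun f2).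
Proof.
have ev : set_val (projT2 f1) = set_val (projT2 f2).
  exact: (congr1 (fun z : MUob U => set_val (projT2 z)) e).
have ei : btgt (projT1 f1) = bsrc (projT1 f2) := congr1 (@projT1 _ _) e.
have y0 : Bcover (bsrc (projT1 f1)) (set_val (projT2 f2)).
  by rewrite -ev; exact: Bcover_sub (insetP (projT2 f1)).
rewrite /functor_of_fun.
have -> : tf g (inset (conj (Bcover_sub (insetP (projT2 f1)))
                              (insetP (projT2 f1)))) =
            tf g (inset (conj y0 (Bcover_sub (insetP (projT2 f2))))).
  by apply: tf_eq; [exact: ei | exact: ev].
rewrite -(tf_cocycle g y0 _ (insetP (projT2 f2))).
by congr (tf g _); exact: val_inj.
Qed.

Definition functor_of : functor :=
  Functor functor_of_map functor_of_id functor_of_comp.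

Lemma functor_of_restricts : restricts_to functor_of g.
Proof. by []. Qed.

End FunctorOf.
End Functors.

Section CoverHom.
Variables (K : Type) (M M' : space K) (L L' : choiceType).
Variables (U : open_cover M L) (U' : open_cover M' L').

Record cover_hom := CoverHom {
  base_fun :> M' -> M;
  base_map : is_map base_fun;
  index_map : L' -> L;
  index_map_sub : forall l, U' l `<=` base_fun @^-1` U (index_map l) }.

Variable u : cover_hom.

Lemma Bpull_sub (s : {fset L'}) :
  finite_meet U' s `<=` u @^-1` finite_meet U (index_map u @` s)%fset.
Proof.
by move=> x Ux l /= /imfsetP[l' /= l's ->]; apply: index_map_sub; exact: Ux.
Qed.

Lemma Bpull_subproof (s : Bindex U') :
  ((index_map u @` val s)%fset != fset0) &&
  `[< finite_meet U (index_map u @` val s)%fset !=set0 >].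
Proof.
case/andP: (valP s) => s0 /asboolP[x Ux]; apply/andP; split.
  have [l ls] := fset0Pn _ s0; apply/fset0Pn; exists (index_map u l).
  exact: in_imfset.
by apply/asboolP; exists (u x); exact: Bpull_sub.
Qed.

Definition Bpull (s : Bindex U') : Bindex U :=
  exist (fun t : {fset L} => (t != fset0) && `[< finite_meet U t !=set0 >])
    (index_map u @` val s)%fset (Bpull_subproof s).

Lemma Bpull_cover (s : Bindex U') (x : M') :
  Bcover s x -> Bcover (Bpull s) (u x).
Proof. exact: Bpull_sub. Qed.

Lemma Bpull_pair_subproof (p : Bpair U') :
  (val (Bpull (bsrc p)) `<=` val (Bpull (btgt p)))%fset.
Proof.
apply/fsubsetP => l /imfsetP[l' /= l's ->]; apply: in_imfset => /=.
by move: (valP p) => /fsubsetP; apply.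
Qed.

Definition Bpull_pair (p : Bpair U') : Bpair U :=
  exist (fun q : Bindex U * Bindex U => (val q.1 `<=` val q.2)%fset)
    (Bpull (bsrc p), Bpull (btgt p)) (Bpull_pair_subproof p).

Definition MUpull (f : MUmor U') : MUmor U :=
  existT _ (Bpull_pair (projT1 f)) (inset (Bpull_cover (insetP (projT2 f)))).

End CoverHom.
Arguments Bpull_cover {K M M' L L' U U'} u {s x}.

Section Pullback.
Variables (R : realType) (c : kind) (M M' : manifold R c) (G G' : group_of R c).
Variables (L L' : choiceType) (U : open_cover M L) (U' : open_cover M' L').
Variables (u : cover_hom U U') (h : group_hom G G').

Section System.
Variable g : transition_system G (@Bcover _ _ U).

Lemma pull_sub (i j : Bindex U') (x : M') : (Bcover i `&` Bcover j) x ->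
  (Bcover (Bpull u i) `&` Bcover (Bpull u j)) (u x).
Proof. by move=> [xi xj]; split; apply: Bpull_cover. Qed.

Definition pull_tf (i j : Bindex U') (y : induced (Bcover i `&` Bcover j)) :
    G' :=
  h (tf g (inset (pull_sub (insetP y)))).

Lemma pull_tf_map i j : is_map (@pull_tf i j).
Proof.
pose k (y : induced (Bcover i `&` Bcover j)) :
    induced (Bcover (Bpull u i) `&` Bcover (Bpull u j)) :=
  inset (pull_sub (insetP y)).
have km : is_map k.
  by apply: is_map_induced; exact: is_map_comp (base_map u) (is_map_set_val _).
exact: is_map_comp (hom_map h) (is_map_comp (tf_map g _ _) km).
Qed.

Lemma pull_tf_cocycle i j k y (yi : Bcover i y) (yj : Bcover j y)
    (yk : Bcover k y) :
  @pull_tf i k (inset (conj yi yk)) =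
  gmul (@pull_tf i j (inset (conj yi yj))) (@pull_tf j k (inset (conj yj yk))).
Proof.
rewrite /pull_tf -hom_mul; congr (h _).
have := tf_cocycle g (Bpull_cover u yi) (Bpull_cover u yj) (Bpull_cover u yk).
by congr (_ = gmul _ _); congr (tf g _); exact: val_inj.
Qed.

Definition pull_system : transition_system G' (@Bcover _ _ U') :=
  TransitionSystem pull_tf_map pull_tf_cocycle.

End System.

Section Functor.
Variable F : functor G U.

Lemma MUpull_map : is_map (MUpull u).
Proof.
apply: is_map_coprod => p.
pose k (x : induced (Bcover (btgt p))) :
    induced (Bcover (btgt (Bpull_pair u p))) :=
  inset (Bpull_cover u (insetP x)).
have km : is_map k.
  by apply: is_map_induced; exact: is_map_comp (base_map u) (is_map_set_val _).
exact: is_map_comp (@is_map_existT _ _ _ (Bpull_pair u p)) km.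
Qed.

Lemma pull_functor_map : is_map (h \o F \o MUpull u).
Proof.
exact: is_map_comp (is_map_comp (hom_map h) (fmor_map F)) MUpull_map.
Qed.

Lemma hom_one : h (gone G) = gone G'.
Proof. by apply: gmul_idem; rewrite -hom_mul gmul1g. Qed.

Lemma MUmor_eq (f1 f2 : MUmor U) :
  val (projT1 f1) = val (projT1 f2) ->
  set_val (projT2 f1) = set_val (projT2 f2) -> f1 = f2.
Proof.
case: f1 => p x; case: f2 => q y /= /val_inj e; subst q.
by move=> /val_inj->.
Qed.

Lemma MUob_eq (x y : MUob U) :
  projT1 x = projT1 y -> set_val (projT2 x) = set_val (projT2 y) -> x = y.
Proof.
by case: x => s x; case: y => t y /= e; subst t; move=> /val_inj->.
Qed.

Lemma pull_functor_id (x : MUob U') :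
  (h \o F \o MUpull u) (MUid x) = gone G'.
Proof.
pose x' : MUob U :=
  existT _ (Bpull u (projT1 x)) (inset (Bpull_cover u (insetP (projT2 x)))).
have e : MUpull u (MUid x) = MUid x' by exact: MUmor_eq.
by rewrite -hom_one -(fmor_id F x') -e.
Qed.

Lemma pull_functor_comp (f1 f2 : MUmor U') (e : MUtgt f1 = MUsrc f2) :
  (h \o F \o MUpull u) (MUcomp e) =
  gmul ((h \o F \o MUpull u) f1) ((h \o F \o MUpull u) f2).
Proof.
have e' : MUtgt (MUpull u f1) = MUsrc (MUpull u f2).
  apply: MUob_eq.
    exact: (congr1 (fun z : MUob U' => Bpull u (projT1 z)) e).
  exact: (congr1 (fun z : MUob U' => u (set_val (projT2 z))) e).
rewrite /= -hom_mul -(fmor_comp F e'); congr (h (F _)).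
exact: MUmor_eq.
Qed.

Definition pull_functor : functor G' U' :=
  Functor pull_functor_map pull_functor_id pull_functor_comp.

End Functor.
End Pullback.

(* Main.v *)
From Corelib Require Import RelationClasses.
Require Import Defs.
From mathcomp Require Import all_boot all_order all_algebra.
From mathcomp Require Import finmap.
From mathcomp Require Import all_classical all_reals all_analysis.
Import Defs numFieldNormedType.Exports.

Set Implicit Arguments.
Unset Strict Implicit.
Unset Printing Implicit Defensive.

Local Open Scope classical_set_scope.
Local Open Scope ring_scope.

(** A functor F on the Segal category only records the transition maps along
    inclusions of indices.  The remaining ones are forced: for arbitrary
    indices s and t the set U_s meets U_t in U_m with m the union of s and t,
    and over U_m the cocycle condition gives g_(s,t) g_(t,m) = g_(s,m), hence

      g_(s,t) = F(s <= m) F(t <= m)^-1.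

    Conversely this formula turns a functor into a system of transition
    functions ([system_of]).  By functoriality its value at y is the same for
    every index m above s and t whose open set contains y ([transitionE]), so
    the cocycle condition can be checked at a single index above the three
    involved.  The two constructions are therefore mutually inverse before
    passing to classes ([functor_ofK], [system_ofK]).  Both equivalence
    relations are given by the same data, a map to G on each U_s; a gauge
    transformation that relates two functors along inclusions relates the
    corresponding systems at all pairs, again by the formula above
    ([functor_of_equiv], [system_of_equiv]).  Naturality already holds on
    representatives ([pull_functor_of]).

    What needs geometry is that the new families consist of maps of the
    category.  Pointwise products of maps to G are maps because
    multiplication is a morphism on the categorical product G * G, whose
    universal property only speaks of objects of the category as sources.
    Hence the open subsets of M have to be shown to be such objects
    ([is_object_open]): an open subset of a manifold is a manifold, and in the
    topological case the sheaf of a manifold is the sheaf of all continuous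
    functions ([locally_model_continuous]). *)

(** * Open subsets of manifolds *)

Section OpenSubset.
Variable K : Type.

Lemma inset_val (T : Type) (A : set T) (x : A) (Ax : A (set_val x)) :
  inset Ax = x.
Proof. exact: val_inj. Qed.

(** The converse of [set_val_near]; openness of A makes neighbourhoods in A
    neighbourhoods in X. *)
Lemma open_near_val (X : space K) (A : set X) (x : induced A) (P : set X) :
  open A -> (\forall y \near x, P (set_val y)) -> \forall z \near set_val x, P z.
Proof.
move=> oA [B [[C oC <-] Cx CP]].
have : nbhs (set_val x) (C `&` A).
  by apply: open_nbhs_nbhs; split; [exact: openI | split=> //; exact: insetP].
by apply: filterS => z [Cz Az]; exact: (CP (inset Az)).
Qed.


End OpenSubset.

Section Models.
Variables (R : realType) (c : kind).

(** For varieties the equations stay the same and W only shrinks the ambient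
    open set, so the Jacobian criterion is inherited. *)
Lemma is_model_openI n (V W : set (affine R c n)) :
  is_model V -> open W -> is_model (V `&` W).
Proof.
case: c V W => /= [| | | |k] V W; try exact: openI.
move=> [W0 [r [p [oW0 -> rf]]]] oW.
exists (W0 `&` W), r, p; split; first exact: openI.
  by apply/seteqP; split=> x [] [? ?] ?.
by move=> x [/rf].
Qed.

(** A chart of X around a point of A restricts to A: the part of its model V
    that lands in A is open in V, so it is cut out of V by an open set W of the
    affine space, and the restricted chart has model V `&` W. *)
Lemma locally_model_open (X : space (Defs.scalar R c)) (A : set X) :
  locally_model X -> open A -> locally_model (induced A).
Proof.
move=> lX oA x; have [U [n [V [oU Ux mV]]]] := lX (set_val x).
case=> f [g [fm gm fK gK]].
pose O : set (induced V) := [set v | A (set_val (g v))].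
have oO : open O.
  have /continuousP cg := (is_map_comp (is_map_set_val _) gm).1.
  exact: cg.
have [W oW WO] : exists2 W : set (affine R c n), open W & set_val @^-1` W = O.
  by case: oO => W; exists W.
pose U' : set (induced A) := set_val @^-1` U.
pose kf (y : induced U') : induced U := inset (insetP y : U (set_val (set_val y))).
have kfm : is_map kf.
  apply: is_map_induced.
  exact: is_map_comp (@is_map_set_val _ X A) (@is_map_set_val _ (induced A) U').
have fW (y : induced U') : (V `&` W) (set_val (f (kf y))).
  split; first exact: insetP.
  have : O (f (kf y)) by rewrite /O /= fK; exact: (insetP (set_val y)).
  by rewrite -WO.
pose kg (v : induced (V `&` W)) : induced V := inset (insetP v).1.
have kgm : is_map kg by apply: is_map_induced; exact: is_map_set_val.
have gA (v : induced (V `&` W)) : A (set_val (g (kg v))).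
  have : O (kg v) by rewrite -WO; exact: (insetP v).2.
  by [].
have gU (v : induced (V `&` W)) : U' (inset (gA v)) by exact: (insetP (g (kg v))).
exists U', n, (V `&` W); split=> //.
- have /continuousP cv := (@is_map_set_val _ X A).1.
  exact: cv.
- exact: is_model_openI.
exists (fun y => inset (fW y)), (fun v => inset (gU v)); split.
- apply: is_map_induced.
  exact: (is_map_comp (is_map_set_val _) (is_map_comp fm kfm)).
- apply: is_map_induced; apply: is_map_induced.
  exact: (is_map_comp (is_map_set_val _) (is_map_comp gm kgm)).
- move=> y; apply/val_inj/val_inj => /=.
  have -> : kg (inset (fW y)) = f (kf y) by exact: val_inj.
  by rewrite fK.
- move=> v; apply/val_inj => /=.
  have -> : kf (inset (gU v)) = g (kg v) by exact: val_inj.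
  by rewrite gK.
Qed.

Lemma separated_subset (X : space (Defs.scalar R c)) (A : set X) :
  Defs.separated X -> Defs.separated (induced A).
Proof.
have hausd (T : space (Defs.scalar R c)) (B : set T) :
    hausdorff_space T -> hausdorff_space (induced B).
  move=> hT p q pq; apply/val_inj/hT => C D Cp Dq.
  have [z [Cz Dz]] := pq _ _ (set_val_near Cp) (set_val_near Dq).
  by exists (set_val z).
case: c X A hausd => [| | | |k] /= X A hausd; try exact: hausd.
move=> sX Y f g lY fm gm.
have -> : [set y | f y = g y] =
    [set y | (set_val \o f) y = (set_val \o g) y].
  by apply/seteqP; split=> y /= => [->//|/val_inj].
by apply: sX => //; exact: is_map_comp (is_map_set_val _) _.
Qed.

End Models.


(** * Topological manifolds carry the sheaf of continuous functions *)

Section ContinuousSpaces.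
Variable R : realType.
Implicit Types X Y : space R.

Lemma open_near_continuous X (A : set X) (x : induced A) (g : X -> R) :
  open A ->
  (\forall y \near x, {for y, continuous (g \o set_val : induced A -> R)}) <->
  \forall z \near set_val x, {for z, continuous g}.
Proof.
move=> oA; have [cv _] := @is_map_set_val _ X A; split=> [|/set_val_near] gx.
  apply: open_near_val (oA) _; apply: filterS gx => y gy B By.
  exact: (open_near_val (P := g @^-1` B) oA (gy B By)).
by apply: filterS gx => y; exact: continuous_comp (cv y).
Qed.

Lemma open_regular X (A : set X) (x : induced A) (g : X -> R) : open A ->
  @regular _ (induced A) x (g \o set_val) <-> regular (set_val x) g.
Proof.
move=> oA; split=> [[h hx gh]|]; last exact: (@is_map_set_val _ X A).2.
apply: regular_germ hx.
have := @open_near_val _ _ _ _ [set z | g z = h z] oA gh.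
by apply: filterS => z ->.
Qed.

(** A function on A is compared with regular functions of X through an
    extension by 0, whose values off the open set A do not affect its germs at
    points of A. *)
Lemma continuous_space_open X (A : set X) :
  is_continuous_space X -> open A -> is_continuous_space (induced A).
Proof.
move=> cX oA x f.
pose g (z : X) : R := if pselect (A z) is left Az then f (inset Az) else 0.
have -> : f = g \o set_val.
  apply/funext => y; rewrite /g /=; case: pselect => [Ay|[]].
    by rewrite inset_val.
  exact: (insetP y).
rewrite open_regular // open_near_continuous //; exact: cX.
Qed.

Lemma continuous_space_isomorphic X Y :
  isomorphic X Y -> is_continuous_space Y -> is_continuous_space X.
Proof.
case=> f [g [[cf rf] [cg rg] fK gK]] cY x h.
have hE : h = (h \o g) \o f by apply/funext => z; rewrite /= fK.
split=> hx.
  have hfx : regular (f x) (h \o g) by apply: rg; rewrite fK.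
  have : \forall y \near x, {for f y, continuous (h \o g : Y -> R)}.
    exact: cf (proj1 (cY _ _) hfx).
  by apply: filterS => y hy; rewrite hE; exact: continuous_comp (cf y) hy.
rewrite hE; apply/rf/cY.
have : \forall y \near f x, {for g y, continuous (h : X -> R)}.
  by apply: (cg (f x) [set z | {for z, continuous (h : X -> R)}]); rewrite fK.
by apply: filterS => y; exact: continuous_comp (cg y).
Qed.

Lemma locally_model_continuous X :
  @locally_model R Topological X -> is_continuous_space X.
Proof.
move=> lX x f; have [U [n [V [oU Ux oV UV]]]] := lX x.
have cU : is_continuous_space (induced U).
  by apply: continuous_space_isomorphic UV _; exact: continuous_space_open.
rewrite -(open_regular (inset Ux)) //.
rewrite -(open_near_continuous (inset Ux)) //; exact: cU.
Qed.

End ContinuousSpaces.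

Lemma is_object_open (R : realType) (c : kind) (X : space (Defs.scalar R c))
    (A : set X) :
  is_manifold X -> open A -> is_object (induced A).
Proof.
move=> [lX sX] oA; have mA : is_manifold (induced A).
  by split; [exact: locally_model_open | exact: separated_subset].
case: c X A lX sX oA mA => //= X A _ _ _ [lA _].
exact: locally_model_continuous.
Qed.

(** * Group objects *)

Section Groups.
Variables (R : realType) (c : kind) (G : group_of R c).
Implicit Types a b : G.

Lemma gmulgV a : gmul a (ginv a) = gone G.
Proof.
rewrite -[LHS]gmul1g -{1}(gmulVg (ginv a)) -gmulA (gmulA (ginv a) a).
by rewrite gmulVg gmul1g gmulVg.
Qed.

Lemma gmulg1 a : gmul a (gone G) = a.
Proof. by rewrite -(gmulVg a) gmulA gmulgV gmul1g. Qed.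

Lemma gmulKg a b : gmul (ginv a) (gmul a b) = b.
Proof. by rewrite gmulA gmulVg gmul1g. Qed.

Lemma gmulVKg a b : gmul a (gmul (ginv a) b) = b.
Proof. by rewrite gmulA gmulgV gmul1g. Qed.

Lemma ginv_eq a b : gmul a b = gone G -> b = ginv a.
Proof. by move=> ab; rewrite -(gmulKg a b) ab gmulg1. Qed.

Lemma ginv1 : ginv (gone G) = gone G.
Proof. by rewrite -(ginv_eq (gmul1g (gone G))). Qed.

Lemma ginvK a : ginv (ginv a) = a.
Proof. by rewrite -(ginv_eq (gmulVg a)). Qed.

Lemma ginvM a b : ginv (gmul a b) = gmul (ginv b) (ginv a).
Proof. by apply/esym/ginv_eq; rewrite -gmulA gmulVKg gmulgV. Qed.

(** The pair (f, g) is a map into the categorical product only when T is an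
    object of the category; this is what [is_object_open] supplies. *)
Lemma is_map_mul (T : space (Defs.scalar R c)) (f g : T -> G) :
  is_object T -> is_map f -> is_map g -> is_map (fun x => gmul (f x) (g x)).
Proof.
move=> oT fm gm; have [P [p1 [p2 [[_ _ _ univ] mulm]]]] := gmul_map G.
have [h [[hm <- <-] _]] := univ T f g oT fm gm.
exact: is_map_comp mulm hm.
Qed.

Lemma is_map_inv (T : space (Defs.scalar R c)) (f : T -> G) :
  is_map f -> is_map (fun x => ginv (f x)).
Proof. by move=> fm; exact: is_map_comp (ginv_map G) fm. Qed.

End Groups.

(** * Maps between sets of equivalence classes *)

Lemma class_of_eq (T : Type) (e : T -> T -> Prop) x y : Equivalence e ->
  e x y -> class_of e x = class_of e y.
Proof.
move=> [_ sym tr] xy; apply: eq_exist; apply/seteqP; split=> z /=.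
  exact: tr (sym _ _ xy).
exact: tr xy.
Qed.

Lemma class_of_surj (T : Type) (e : T -> T -> Prop) (C : classes e) :
  exists x, C = class_of e x.
Proof. by case: C => C [x Cx]; exists x; exact: eq_exist. Qed.

Section ClassMaps.
Variables (T T' : Type) (e : T -> T -> Prop) (e' : T' -> T' -> Prop).

Definition class_map (f : T -> T') (C : classes e) : classes e' :=
  class_of e' (f (sval (cid (class_of_surj C)))).

Lemma class_mapE (f : T -> T') x : Equivalence e -> Equivalence e' ->
  (forall y z, e y z -> e' (f y) (f z)) ->
  class_map f (class_of e x) = class_of e' (f x).
Proof.
move=> eqe eqe' ff'; rewrite /class_map; case: cid => y /= xy.
apply: class_of_eq => //; apply: ff'.
have : [set z | e x z] = [set z | e y z] := congr1 (@proj1_sig _ _) xy.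
by move/seteqP => [/(_ x) H _]; apply: H; exact: Equivalence_Reflexive.
Qed.

End ClassMaps.

Lemma class_map_can (T T' : Type) (e : T -> T -> Prop) (e' : T' -> T' -> Prop)
    (f : T -> T') (g : T' -> T) :
  Equivalence e -> Equivalence e' ->
  (forall y z, e y z -> e' (f y) (f z)) ->
  (forall y z, e' y z -> e (g y) (g z)) ->
  cancel f g -> cancel (class_map e' f) (class_map e g).
Proof.
move=> eqe eqe' fe ge fK C; have [x ->] := class_of_surj C.
by rewrite !class_mapE // fK.
Qed.

(** * Transition functions relative to an open cover *)

Section TransitionSystems.
Variables (R : realType) (c : kind) (M : manifold R c) (G : group_of R c).
Variables (I : Type) (V : I -> set M).
Implicit Types g : transition_system G V.

Lemma transition_system_eq g g' :
  (forall i j (x : induced (V i `&` V j)), tf g x = tf g' x) -> g = g'.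
Proof.
case: g => t tm tc; case: g' => t' tm' tc' /= tt'.
have e : t = t'.
  by apply: functional_extensionality_dep => i;
     apply: functional_extensionality_dep => j; apply/funext => x; exact: tt'.
by case: t' / e tm' tc' tt' => tm' tc' _; congr TransitionSystem;
   exact: Prop_irrelevance.
Qed.

Lemma tf_diag g i y (yi yi' : V i y) : tf g (inset (conj yi yi')) = gone G.
Proof.
apply: gmul_idem; rewrite (Prop_irrelevance yi' yi).
exact: tf_cocycle.
Qed.

(** Constant functions to G need not be maps for an arbitrary sheaf; here the
    neutral one is, being the diagonal transition function g_(i,i). *)
Lemma is_map_one g i : is_map (fun _ : induced (V i) => gone G).
Proof.
pose d (x : induced (V i)) : induced (V i `&` V i) :=
  inset (conj (insetP x) (insetP x)).
have -> : (fun _ => gone G) = tf g (i := i) (j := i) \o d.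
  by apply/funext => x; rewrite /= tf_diag.
apply: is_map_comp (tf_map g _ _) _; apply: is_map_induced.
exact: is_map_set_val.
Qed.

Hypothesis openV : forall i, open (V i).

Lemma system_equiv_equivalence : Equivalence (@system_equiv R c M G I V).
Proof.
split.
- move=> g; exists (fun _ _ => gone G); split=> [i|i j y yi yj].
    exact: is_map_one.
  by rewrite ginv1 gmul1g gmulg1.
- move=> g g' [r [rm rE]];
  exists (fun i x => ginv (r i x)); split=> [i|i j y yi yj].
    exact: is_map_inv.
  by rewrite rE ginvK -!gmulA gmulVKg gmulgV gmulg1.
- move=> g1 g2 g3 [r [rm rE]] [s [sm sE]].
  exists (fun i x => gmul (r i x) (s i x)); split=> [i|i j y yi yj].
    by apply: is_map_mul => //; exact: is_object_open (manifoldP M) _.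
  by rewrite sE rE ginvM -!gmulA.
Qed.

End TransitionSystems.

(** * Unions of indices *)

Section NerveIndices.
Variables (T : topologicalType) (L : choiceType) (U : open_cover T L).
Implicit Types i j k : Bindex U.

Lemma open_Bcover i : open (Bcover i).
Proof.
rewrite openE => x Ux; apply: (@filter_bigI _ _ (val i) U (nbhs x)) => l li.
by apply: open_nbhs_nbhs; split; [exact: cover_open | exact: Ux].
Qed.

Lemma finite_meetU (s t : {fset L}) y :
  finite_meet U s y -> finite_meet U t y -> finite_meet U (s `|` t)%fset y.
Proof. by move=> sy ty l /=; rewrite in_fsetU => /orP[/sy|/ty]. Qed.

Lemma Bjoin_subproof i j y : Bcover i y -> Bcover j y ->
  ((val i `|` val j)%fset != fset0) &&
  `[< finite_meet U (val i `|` val j)%fset !=set0 >].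
Proof.
move=> yi yj; apply/andP; split; last first.
  by apply/asboolP; exists y; exact: finite_meetU.
case/andP: (valP i) => /fset0Pn[l li] _; apply/fset0Pn; exists l.
by rewrite in_fsetU li.
Qed.

(** The point y witnesses that the union of the two indices still has a
    nonempty intersection; up to this proof the index does not depend on y. *)
Definition Bjoin i j y (yi : Bcover i y) (yj : Bcover j y) : Bindex U :=
  exist _ (val i `|` val j)%fset (Bjoin_subproof yi yj).

Lemma Bjoin_cover i j y (yi : Bcover i y) (yj : Bcover j y) z :
  Bcover i z -> Bcover j z -> Bcover (Bjoin yi yj) z.
Proof. exact: finite_meetU. Qed.

Lemma Bjoin_subl i j y (yi : Bcover i y) (yj : Bcover j y) :
  (val i `<=` val (Bjoin yi yj))%fset.
Proof. exact: fsubsetUl. Qed.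

Lemma Bjoin_subr i j y (yi : Bcover i y) (yj : Bcover j y) :
  (val j `<=` val (Bjoin yi yj))%fset.
Proof. exact: fsubsetUr. Qed.

End NerveIndices.
Arguments Bjoin_cover {T L U i j y} yi yj {z} _ _.

(** * From functors back to transition functions *)

Section FunctorSystems.
Variables (R : realType) (c : kind) (M : manifold R c) (G : group_of R c).
Variables (L : choiceType) (U : open_cover M L).
Implicit Types (i j k m : Bindex U) (F : functor G U).

Definition arrow i k (ik : (val i `<=` val k)%fset) y (yk : Bcover k y) :
    MUmor U :=
  existT _ (exist _ (i, k) ik : Bpair U) (inset yk).

Lemma functor_eq F F' : (forall f, F f = F' f) -> F = F'.
Proof.
case: F => t tm ti tc; case: F' => t' tm' ti' tc' /= /funext e.
by subst t'; congr Functor; exact: Prop_irrelevance.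
Qed.

Lemma functor_arrow F i k m (ik : (val i `<=` val k)%fset)
    (km : (val k `<=` val m)%fset) (im : (val i `<=` val m)%fset)
    y (yk : Bcover k y) (ym : Bcover m y) :
  F (arrow im ym) = gmul (F (arrow ik yk)) (F (arrow km ym)).
Proof.
have e : MUtgt (arrow ik yk) = MUsrc (arrow km ym) by exact: MUob_eq.
by rewrite -(fmor_comp F e); congr (F _); exact: MUmor_eq.
Qed.

Lemma functor_arrow_map F i k (ik : (val i `<=` val k)%fset) :
  is_map (fun x : induced (Bcover k) => F (arrow ik (insetP x))).
Proof.
have e : (fun x : induced (Bcover k) => F (arrow ik (insetP x))) =
    F \o (fun x => existT _ (exist _ (i, k) ik : Bpair U) x).
  by apply/funext => x; congr (F _); exact: MUmor_eq.
rewrite e; apply: is_map_comp (fmor_map F) _.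
exact: (@is_map_existT _ _ (fun p : Bpair U => induced (Bcover (btgt p)))
          (exist _ (i, k) ik)).
Qed.

Definition transition F i j (x : induced (Bcover i `&` Bcover j)) : G :=
  let: conj xi xj := insetP x in
  let xk := Bjoin_cover xi xj xi xj in
  gmul (F (arrow (Bjoin_subl xi xj) xk))
    (ginv (F (arrow (Bjoin_subr xi xj) xk))).

(** Independence of the upper index: if k is the union of i and j, then m is
    above k, and the common factor F(k <= m) cancels. *)
Lemma transitionE F i j m (im : (val i `<=` val m)%fset)
    (jm : (val j `<=` val m)%fset) (x : induced (Bcover i `&` Bcover j))
    (xm : Bcover m (set_val x)) :
  transition F x = gmul (F (arrow im xm)) (ginv (F (arrow jm xm))).
Proof.
rewrite /transition; case: (insetP x) => xi xj.
have km : (val (Bjoin xi xj) `<=` val m)%fset by rewrite /= fsubUset im jm.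
have xk := Bjoin_cover xi xj xi xj.
rewrite (functor_arrow F (Bjoin_subl xi xj) km im xk).
rewrite (functor_arrow F (Bjoin_subr xi xj) km jm xk).
rewrite ginvM -!gmulA gmulVKg.
by congr (gmul (F _) (ginv (F _))); exact: MUmor_eq.
Qed.

(** The index used by [transition] depends on the point through a proof, so a
    single index is fixed first; it exists unless the domain is empty. *)
Lemma transition_map F i j : is_map (@transition F i j).
Proof.
have [[y [yi yj]]|V0] := pselect ((Bcover i `&` Bcover j) !=set0); last first.
  by split=> x; case: V0; exists (set_val x); exact: insetP.
pose k := Bjoin yi yj.
have xk (x : induced (Bcover i `&` Bcover j)) : Bcover k (set_val x).
  by case: (insetP x) => xi xj; exact: Bjoin_cover.
pose w (x : induced (Bcover i `&` Bcover j)) : induced (Bcover k) :=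
  inset (xk x).
have wm : is_map w by apply: is_map_induced; exact: is_map_set_val.
have -> : @transition F i j = fun x =>
    gmul (F (arrow (Bjoin_subl yi yj) (insetP (w x))))
         (ginv (F (arrow (Bjoin_subr yi yj) (insetP (w x))))).
  by apply/funext => x; exact: transitionE.
apply: is_map_mul; first 1 last.
- exact: is_map_comp (functor_arrow_map F (Bjoin_subl yi yj)) wm.
- apply: is_map_inv.
  exact: is_map_comp (functor_arrow_map F (Bjoin_subr yi yj)) wm.
apply: is_object_open (manifoldP M) _; apply: openI; exact: open_Bcover.
Qed.

Lemma transition_cocycle F i j k y (yi : Bcover i y) (yj : Bcover j y)
    (yk : Bcover k y) :
  transition F (inset (conj yi yk)) =
  gmul (transition F (inset (conj yi yj))) (transition F (inset (conj yj yk))).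
Proof.
pose ij := Bjoin yi yj; have yij : Bcover ij y by exact: Bjoin_cover.
pose m := Bjoin yij yk; have ym : Bcover m y by exact: Bjoin_cover.
have ijm : (val ij `<=` val m)%fset by exact: Bjoin_subl.
have im : (val i `<=` val m)%fset.
  by apply: fsubset_trans ijm; exact: Bjoin_subl.
have jm : (val j `<=` val m)%fset.
  by apply: fsubset_trans ijm; exact: Bjoin_subr.
have km : (val k `<=` val m)%fset by exact: Bjoin_subr.
rewrite (transitionE F im km (x := inset (conj yi yk)) ym).
rewrite (transitionE F im jm (x := inset (conj yi yj)) ym).
rewrite (transitionE F jm km (x := inset (conj yj yk)) ym).
by rewrite -!gmulA gmulKg.
Qed.

Definition system_of F : transition_system G (@Bcover M L U) :=
  TransitionSystem (transition_map F) (transition_cocycle F).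

Lemma restricts_toP F (g : transition_system G (@Bcover M L U)) :
  restricts_to F g <-> F = functor_of g.
Proof.
split=> [Fg|->]; last exact: functor_of_restricts.
by apply: functor_eq => -[p x]; exact: Fg.
Qed.

Lemma functor_ofK : cancel (@functor_of R c M G L U) system_of.
Proof.
move=> g; apply: transition_system_eq => i j x /=.
have [xi xj] := insetP x; have xk := Bjoin_cover xi xj xi xj.
rewrite (transitionE _ (Bjoin_subl xi xj) (Bjoin_subr xi xj) xk).
have -> : tf g x = tf g (inset (conj xi xj)) by congr (tf g _); exact: val_inj.
rewrite /= /functor_of_fun /=.
set a := tf g _; set b := tf g _.
suff -> : a = gmul (tf g (inset (conj xi xj))) b.
  by rewrite -gmulA gmulgV gmulg1.
have := tf_cocycle g xi xj xk.
by congr (_ = gmul _ _); congr (tf g _); exact: val_inj.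
Qed.

Lemma transition_sub F i j (ij : (val i `<=` val j)%fset)
    (x : induced (Bcover i `&` Bcover j)) (xj : Bcover j (set_val x)) :
  transition F x = F (arrow ij xj).
Proof.
rewrite (transitionE F ij (fsubset_refl _) xj).
have -> : F (arrow (fsubset_refl _) xj) = gone G.
  by rewrite -(fmor_id F (existT _ j (inset xj))); congr (F _); exact: MUmor_eq.
by rewrite ginv1 gmulg1.
Qed.

Lemma system_ofK : cancel system_of (@functor_of R c M G L U).
Proof.
move=> F; apply/esym/restricts_toP => -[[i j] /= ij] x /=.
rewrite (transition_sub F ij); first exact: (insetP x).
by move=> xj; congr (F _); exact: MUmor_eq.
Qed.

Lemma functor_of_equiv (g g' : transition_system G (@Bcover M L U)) :
  system_equiv g g' -> functor_equiv (functor_of g) (functor_of g').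
Proof.
case=> r [rm rE]; exists (fun z => r (projT1 z) (projT2 z)); split.
  by apply: is_map_coprod => i; exact: rm.
move=> [p x] /=; rewrite /functor_of_fun /= rE inset_val.
by rewrite -!gmulA gmulVKg.
Qed.

(** The gauge condition holds a priori only along inclusions.  Applying it to
    i <= m and j <= m, with m the union, the factors Phi_m cancel in the
    quotient that defines the (i,j) transition function. *)
Lemma system_of_equiv F F' :
  functor_equiv F F' -> system_equiv (system_of F) (system_of F').
Proof.
case=> Phi [Phim PhiE]; exists (fun i x => Phi (existT _ i x)); split.
  by move=> i; exact: is_map_comp Phim (@is_map_existT _ _ _ i).
move=> i j y yi yj /=; have yk := Bjoin_cover yi yj yi yj.
rewrite !(transitionE _ (Bjoin_subl yi yj) (Bjoin_subr yi yj)
            (x := inset (conj yi yj)) yk).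
have FE s (sk : (val s `<=` val (Bjoin yi yj))%fset) (ys : Bcover s y) :
    F' (arrow sk yk) =
    gmul (ginv (Phi (existT _ s (inset ys))))
      (gmul (F (arrow sk yk)) (Phi (existT _ (Bjoin yi yj) (inset yk)))).
  rewrite (PhiE (arrow sk yk)).
  have -> : MUsrc (arrow sk yk) = existT _ s (inset ys) by exact: MUob_eq.
  by rewrite gmulKg.
rewrite (FE i _ yi) (FE j _ yj) !ginvM ginvK -!gmulA.
by rewrite gmulVKg.
Qed.

Lemma system_equivP : Equivalence (@system_equiv R c M G _ (@Bcover M L U)).
Proof. by apply: system_equiv_equivalence => i; exact: open_Bcover. Qed.

(** Transported from systems of transition functions, where the groupoid laws
    of gauge transformations were checked on each open set separately. *)
Lemma functor_equivP : Equivalence (@functor_equiv R c M G L U).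
Proof.
have [rfl sym tr] := system_equivP; split.
- by move=> F; rewrite -(system_ofK F); apply: functor_of_equiv; exact: rfl.
- move=> F F' /system_of_equiv/sym/functor_of_equiv.
  by rewrite !system_ofK.
- move=> F1 F2 F3 /system_of_equiv e12 /system_of_equiv/(tr _ _ _ e12).
  by move/functor_of_equiv; rewrite !system_ofK.
Qed.

End FunctorSystems.

(** * Naturality *)

Section Naturality.
Variables (R : realType) (c : kind) (M M' : manifold R c) (G G' : group_of R c).
Variables (L L' : choiceType) (U : open_cover M L) (U' : open_cover M' L').
Variables (u : cover_hom U U') (h : group_hom G G').

Lemma hom_inv (a : G) : h (ginv a) = ginv (h a).
Proof. by apply: ginv_eq; rewrite -hom_mul gmulgV hom_one. Qed.

Lemma pull_system_equiv (g g' : transition_system G (@Bcover M L U)) :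
  system_equiv g g' -> system_equiv (pull_system u h g) (pull_system u h g').
Proof.
case=> r [rm rE].
pose w i (x : induced (Bcover i)) : induced (Bcover (Bpull u i)) :=
  inset (Bpull_cover u (insetP x)).
exists (fun i x => h (r _ (w i x))); split=> [i|i j y yi yj] /=.
  have wm : is_map (w i).
    apply: is_map_induced.
    exact: is_map_comp (base_map u) (is_map_set_val _).
  exact: is_map_comp (hom_map h) (is_map_comp (rm _) wm).
rewrite /pull_tf -hom_inv -!hom_mul; congr (h _).
have wE s (ys : Bcover s y) : w s (inset ys) = inset (Bpull_cover u ys).
  exact: val_inj.
rewrite !wE (_ : inset (pull_sub _ _) =
    inset (conj (Bpull_cover u yi) (Bpull_cover u yj))); first exact: rE.
exact: val_inj.
Qed.

Lemma pull_functor_of (g : transition_system G (@Bcover M L U)) :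
  pull_functor u h (functor_of g) = functor_of (pull_system u h g).
Proof.
apply: functor_eq => -[p x] /=; rewrite /functor_of_fun /pull_tf /=.
by congr (h (tf g _)); exact: val_inj.
Qed.

Lemma pull_functor_equiv (F F' : functor G U) :
  functor_equiv F F' -> functor_equiv (pull_functor u h F) (pull_functor u h F').
Proof.
rewrite -{2}(system_ofK F) -{2}(system_ofK F') !pull_functor_of.
by move/system_of_equiv/pull_system_equiv/functor_of_equiv.
Qed.

End Naturality.

(** * The bijection *)

Theorem theorem7p4 (R : realType) (c : kind) :
  exists Theta : forall (M : manifold R c) (G : group_of R c)
      (L : choiceType) (U : open_cover M L),
      H1 G (@Bcover M L U) -> DMU G U,
  [/\ forall (M : manifold R c) (G : group_of R c)
        (L : choiceType) (U : open_cover M L)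
        (g : transition_system G (@Bcover M L U)),
        (forall F : functor G U, restricts_to F g <-> F = functor_of g) /\
        Theta M G L U (class_of (@system_equiv R c M G _ _) g) =
        class_of (@functor_equiv R c M G L U) (functor_of g),
      forall (M : manifold R c) (G : group_of R c)
        (L : choiceType) (U : open_cover M L),
        bijective (Theta M G L U)
    & forall (M M' : manifold R c) (G G' : group_of R c)
        (L L' : choiceType) (U : open_cover M L) (U' : open_cover M' L')
        (u : cover_hom U U') (h : group_hom G G'),
      exists (a : H1 G (@Bcover M L U) -> H1 G' (@Bcover M' L' U'))
        (b : DMU G U -> DMU G' U'),
      [/\ forall g : transition_system G (@Bcover M L U),
            a (class_of (@system_equiv R c M G _ _) g) =
            class_of (@system_equiv R c M' G' _ _) (pull_system u h g),
          forall F : functor G U,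
            b (class_of (@functor_equiv R c M G L U) F) =
            class_of (@functor_equiv R c M' G' L' U') (pull_functor u h F)
        & forall x : H1 G (@Bcover M L U),
            b (Theta M G L U x) = Theta M' G' L' U' (a x)]].
Proof.
exists (fun M G L U => class_map _ (@functor_of R c M G L U)).
have TE M G L U g : class_map _ (@functor_of R c M G L U)
    (class_of (@system_equiv R c M G _ _) g) =
    class_of (@functor_equiv R c M G L U) (functor_of g).
  apply: class_mapE; [exact: system_equivP | exact: functor_equivP |].
  exact: functor_of_equiv.
split=> [M G L U g | M G L U | M M' G G' L L' U U' u h].
- by split=> [F|]; [exact: restricts_toP | exact: TE].
- have sP := @system_equivP R c M G L U; have fP := @functor_equivP R c M G L U.
  exists (class_map _ (@system_of R c M G L U)); apply: class_map_can => //;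
    by [exact: functor_of_equiv | exact: system_of_equiv
       | exact: functor_ofK | exact: system_ofK].
have aE g : class_map (@system_equiv R c M' G' _ (@Bcover M' L' U'))
    (pull_system u h) (class_of (@system_equiv R c M G _ (@Bcover M L U)) g) =
    class_of _ (pull_system u h g).
  apply: class_mapE; [exact: system_equivP | exact: system_equivP |].
  exact: pull_system_equiv.
have bE F : class_map (@functor_equiv R c M' G' L' U') (pull_functor u h)
    (class_of (@functor_equiv R c M G L U) F) = class_of _ (pull_functor u h F).
  apply: class_mapE; [exact: functor_equivP | exact: functor_equivP |].
  exact: pull_functor_equiv.
do 2!eexists; split=> [g|F|C]; [exact: aE | exact: bE |].
have [g ->] := class_of_surj C.
by rewrite aE !TE bE pull_functor_of.
Qed.
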